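(* Let $\sigma:X\to X$ be a permutation of $X=\{1,\dots,n\}$ and let $K$ be an oriented classical knot. Then $$J_\sigma(K)=|\mathcal C_\sigma(K)|\,J_{[1]}(K),$$ where $[1]$ denotes the unique permutation of the one-element set $\{1\}$ and $|\mathcal C_\sigma(K)|$ is the number of $\sigma$-colorings of $K$.
   Context: Diagrams are oriented link diagrams in the plane with classical crossings and possibly virtual crossings (a classical knot is one represented by a diagram without virtual crossings). $J_\sigma(K)$ and $|\mathcal C_\sigma(K)|$ are computed from any diagram $D$ of $K$ and do not depend on the diagram chosen. Colorings. A semiarc of $D$ is an edge of the graph obtained by regarding the classical crossing points as vertices (virtual crossings are ignored; a component with no classical crossing is a single semiarc). A $\sigma$-coloring of $D$ assigns an element of $X$ to each semiarc such that at each classical crossing of sign $\epsilon\in\{+1,-1\}$: if the incoming semiarc of the under-strand has color $x$, its outgoing semiarc has color $\sigma^{\epsilon}(x)$; if the incoming semiarc of the over-strand has color $y$, its outgoing semiarc has color $\sigma^{-\epsilon}(y)$. $\mathcal{C}_\sigma(D)$ is the set of $\sigma$-colorings of $D$. Monochromatic crossings. Draw a crossing with both strands oriented upward. It is monochromatic if the two semiarcs on its left side (one incoming, one outgoing, belonging to different strands) have equal colors, and polychromatic otherwise. (For a positive crossing the left semiarcs are the incoming over-semiarc and the outgoing under-semiarc; for a negative crossing they are the incoming under-semiarc and the outgoing over-semiarc.) States. A Kauffman state $s$ of a $\sigma$-colored diagram $d$ is obtained by replacing each monochromatic crossing by one of its two smoothings and each polychromatic crossing by a virtual crossing. A positive monochromatic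 crossing contributes a factor $a$ for the smoothing compatible with the orientation and $b$ for the other smoothing; a negative monochromatic crossing contributes $a^{-1}$ for the orientation-compatible smoothing and $b^{-1}$ for the other; a polychromatic crossing of sign $\epsilon$ contributes $v^{\epsilon}$. The product of these factors is the monomial $a^xb^yv^z$ of $s$; $|s|$ is the number of closed curves in $s$ (which may cross virtually); $\mathcal S(d)$ is the set of Kauffman states of $d$. The permutation Jones polynomial is the Laurent polynomial in $a,b,v$ with integer coefficients $$J_\sigma(K)=\sum_{d\in\mathcal C_\sigma(D)}(-a^2b^{-1})^{-\mathrm{writhe}(D)}\sum_{s\in\mathcal S(d)}a^xb^yv^z(-ab^{-1}-ba^{-1})^{|s|},$$ where $\mathrm{writhe}(D)$ is the sum of the signs of the classical crossings of $D$. *)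

(* Defs.v *)
From HB Require Import structures.
From mathcomp Require Import all_boot all_order all_fingroup all_algebra.
From mathcomp Require Import mpoly.

Set Implicit Arguments.
Unset Strict Implicit.
Unset Printing Implicit Defensive.

Import GRing.Theory.
Local Open Scope ring_scope.

(* The Laurent polynomial ring Z[a^+-1, b^+-1, v^+-1] is used through its     *)
(* embedding in the field of fractions of Z[a, b, v].                         *)
Notation laurent := {fraction {mpoly int[3]}}.

Definition var_a : laurent := tofrac 'X_(@Ordinal 3 0 isT).
Definition var_b : laurent := tofrac 'X_(@Ordinal 3 1 isT).
Definition var_v : laurent := tofrac 'X_(@Ordinal 3 2 isT).

(* Every crossing is drawn with both strands oriented upward; a side of it is *)
(* a boolean, true for left and false for right.  One strand enters at the    *)
(* bottom left and leaves at the top right, the other one enters at the       *)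
(* bottom right and leaves at the top left.                                   *)
Local Notation left := true (only parsing).
Local Notation right := false (only parsing).

(* [Classical p] has sign +1 if p is true and -1 if p is false.               *)
Inductive crossing_kind := Classical of bool | Virtual.

Definition sign (k : crossing_kind) : int :=
  match k with Classical true => 1 | Classical false => -1 | Virtual => 0 end.

(* Combinatorial map of an oriented 4-valent diagram on a closed surface: the *)
(* edge that leaves the crossing c at the top on side s enters the crossing   *)
(* c' at the bottom on side s', where (c', s') = edge_map (c, s).  Edges are  *)
(* named by the pair (c, s) at which they start.  The closed curves of the    *)
(* diagram that meet no crossing at all are merely counted, by [circles].     *)
Record diagram_map := DiagramMap {
  crossing : finType;
  kind : crossing -> crossing_kind;
  edge_map : {perm crossing * bool};
  circles : nat
}.

Section Map.
Variable D : diagram_map.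

(* The four ends at a crossing: [inl (c, s)] is the outgoing (top) one and    *)
(* [inr (c, s)] the incoming (bottom) one on side s.                          *)
Definition edge_end := ((crossing D * bool) + (crossing D * bool))%type.

Definition other_end (x : edge_end) : edge_end :=
  match x with
  | inl e => inr (edge_map D e)
  | inr e => inl ((edge_map D)^-1%g e)
  end.

(* Counterclockwise: top right, top left, bottom left, bottom right.          *)
Definition rotate (x : edge_end) : edge_end :=
  match x with
  | inl (c, right) => inl (c, left)
  | inl (c, left)  => inr (c, left)
  | inr (c, left)  => inr (c, right)
  | inr (c, right) => inl (c, right)
  end.

Definition end_crossing (x : edge_end) : crossing D :=
  match x with inl e => e.1 | inr e => e.1 end.

(* The orbits are the boundaries of the faces.                                *)
Definition face (x : edge_end) : edge_end := rotate (other_end x).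

Definition adjacent : rel edge_end :=
  fun x y => (y == other_end x) || (end_crossing x == end_crossing y).

(* Euler's formula V - E + F = 2 K, where V = #|crossing D|, E = 2 V and K is *)
(* the number of connected components of the 4-valent graph: all of them have *)
(* genus 0, that is, the map can be drawn in the plane.                       *)
Definition planar : Prop :=
  fcard face predT = (#|crossing D| + 2 * n_comp adjacent predT)%N.

End Map.

Record diagram := Diagram { dmap :> diagram_map; _ : planar dmap }.

Inductive smoothing := Oriented | Unoriented | Crossed.

Definition smoothing_code (t : smoothing) : option bool :=
  match t with
  | Oriented => Some true | Unoriented => Some false | Crossed => None
  end.
Definition smoothing_decode (o : option bool) : smoothing :=
  match o with
  | Some true => Oriented | Some false => Unoriented | None => Crossed
  end.
Lemma smoothing_codeK : cancel smoothing_code smoothing_decode.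
Proof. by case. Qed.

HB.instance Definition _ := Finite.copy smoothing (can_type smoothing_codeK).

Section Diagram.
Variable D : diagram.

Definition classical : Prop := forall c : crossing D, kind c <> Virtual.

(* Going along an edge and then straight through the crossing at its end.     *)
Definition follow (e : crossing D * bool) : crossing D * bool :=
  ((edge_map D e).1, ~~ (edge_map D e).2).

Definition components : nat := (fcard follow predT + circles D)%N.

Definition knot : Prop := components = 1%N.

Definition writhe : int := \sum_(c : crossing D) sign (kind c).

Section Colorings.
Variable n : nat.
Implicit Type d : {ffun (crossing D * bool) + 'I_(circles D) -> 'I_n}.

(* A function on semiarcs is encoded as a function on edges and circles that  *)
(* does not change when passing through a virtual crossing.                   *)
Definition color_out d (e : crossing D * bool) : 'I_n := d (inl e).
Definition color_in d (e : crossing D * bool) : 'I_n :=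
  d (inl ((edge_map D)^-1%g e)).

Definition signed_power (sigma : 'S_n) (p : bool) : 'S_n :=
  if p then sigma else (sigma^-1)%g.

(* The over-strand of a positive crossing enters on the left and leaves on    *)
(* the right; that of a negative crossing enters on the right and leaves on   *)
(* the left.  Thus, at a crossing of sign p, the over-strand goes from side p *)
(* to side ~~ p and the under-strand from side ~~ p to side p.                *)
Definition is_coloring (sigma : 'S_n) d : bool :=
  [forall c : crossing D,
    match kind c with
    | Classical p =>
        (color_out d (c, p) == signed_power sigma p (color_in d (c, ~~ p)))
        && (color_out d (c, ~~ p)
              == signed_power sigma (~~ p) (color_in d (c, p)))
    | Virtual =>
        (color_out d (c, left) == color_in d (c, right))
        && (color_out d (c, right) == color_in d (c, left))
    end].

Definition colorings (sigma : 'S_n) :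
    {set {ffun (crossing D * bool) + 'I_(circles D) -> 'I_n}} :=
  [set d | is_coloring sigma d].

Definition monochromatic d (c : crossing D) : bool :=
  match kind c with
  | Classical _ => color_in d (c, left) == color_out d (c, left)
  | Virtual => false
  end.

(* [Crossed] stands for a virtual crossing, whether it comes from a           *)
(* polychromatic crossing or was already virtual in the diagram.              *)
Definition states d : {set {ffun crossing D -> smoothing}} :=
  [set s : {ffun crossing D -> smoothing} |
    [forall c, (s c != Crossed) == monochromatic d c]].

End Colorings.

Implicit Type s : {ffun crossing D -> smoothing}.

Definition factor s (c : crossing D) : laurent :=
  match kind c with
  | Virtual => 1
  | Classical _ =>
      match s c with
      | Oriented   => var_a ^ sign (kind c)
      | Unoriented => var_b ^ sign (kind c)
      | Crossed    => var_v ^ sign (kind c)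
      end
  end.

Definition joined_end s (x : edge_end D) : edge_end D :=
  match x with
  | inl (c, i) =>
      match s c with
      | Oriented   => inr (c, i)
      | Unoriented => inl (c, ~~ i)
      | Crossed    => inr (c, ~~ i)
      end
  | inr (c, i) =>
      match s c with
      | Oriented   => inl (c, i)
      | Unoriented => inr (c, ~~ i)
      | Crossed    => inl (c, ~~ i)
      end
  end.

Definition curve_step s : rel (edge_end D) :=
  fun x y => (y == other_end x) || (y == joined_end s x).

Definition curves s : nat := (n_comp (curve_step s) predT + circles D)%N.

Definition jones n (sigma : 'S_n) : laurent :=
  \sum_(d in colorings sigma)
    (- (var_a ^+ 2 * var_b^-1)) ^ (- writhe) *
    \sum_(s in states d)
      (\prod_(c : crossing D) factor s c) *
      (- (var_a * var_b^-1) - var_b * var_a^-1) ^+ curves s.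

End Diagram.

(* Main.v *)
(* Every crossing of a colored classical knot is monochromatic, so all        *)
(* colorings contribute the same sum over states.  In a planar diagram the    *)
(* faces carry an Alexander numbering A, which drops by 1 from the left to    *)
(* the right of every edge.  The coloring rule does not depend on the signs   *)
(* of the crossings: passing another strand that comes from the left (right)  *)
(* applies sigma (its inverse), which is also how A on the left of the moving *)
(* point changes.  So sigma^(- A (left face)) applied to the color is         *)
(* constant along the knot, and the two left semiarcs at a crossing, which    *)
(* have the same face on their left, have the same color.  The numbering is a *)
(* face potential for the flow that is 1 on every edge, and exists by Euler's *)
(* formula: flows and coboundaries of faces have equal dimension.             *)
Require Import Defs.
From HB Require Import structures.
From mathcomp Require Import all_boot all_order all_fingroup all_algebra.
From mathcomp Require Import mpoly.
From mathcomp Require Import ring zify.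

Import GRing.Theory Num.Theory.
Local Open Scope ring_scope.

(** By [coloring_monochromatic], the states of any coloring are all the choices of smoothings, so no
    color enters its summand. The numbering used there comes from the count in
    [planar_face_potential]: with V crossings and K components, Euler's formula and [faces_mx_rank]
    give coboundaries dimension at least V + K, while [crossings_mx_rank] gives flows at most that.
    So the flow 1 is a coboundary. *)

Lemma connect_invariant (X : finType) (U : Type) (e : rel X) (w : X -> U) :
  (forall x y, e x y -> w x = w y) -> forall x y, connect e x y -> w x = w y.
Proof.
move=> we x y /connectP[p + ->].
by elim: p x => //= z p IHp x /andP[/we-> /IHp].
Qed.

(* The values at one point of each component determine a row of the kernel.   *)
Lemma invariant_kernel_rank {F : fieldType} {X T : finType} {m : nat}
    (e : rel X) (p : X -> T) (M : 'M[F]_(#|T|, m)) :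
    connect_sym e -> (forall t, exists x, p x = t) ->
    (forall u : 'rV_#|T|, u *m M = 0 ->
      forall x y, e x y -> u 0 (enum_rank (p x)) = u 0 (enum_rank (p y))) ->
  (#|T| <= \rank M + n_comp e predT)%N.
Proof.
move=> sym_e p_surj inv_ker.
(* [u *m P] lists the values of [u] at the component roots; adding these columns to [M] makes its
   rows independent. *)
pose P : 'M[F]_(#|T|, #|roots e|) :=
  \matrix_(i, j) (i == enum_rank (p (enum_val j)))%:R.
have uP (u : 'rV_#|T|) j : (u *m P) 0 j = u 0 (enum_rank (p (enum_val j))).
  rewrite mxE (bigD1 (enum_rank (p (enum_val j)))) //= mxE eqxx mulr1.
  by rewrite big1 ?addr0 // => i /negPf ne_i; rewrite mxE ne_i mulr0.
have free_MP : row_free (row_mx M P).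
  rewrite -kermx_eq0; apply/eqP/row_matrixP => i; rewrite row0.
  set u := row i _.
  have : u *m row_mx M P = 0 by rewrite -row_mul mulmx_ker row0.
  rewrite mul_mx_row -row_mx0 => /eq_row_mx[uM0 uP0].
  apply/rowP => k; rewrite [RHS]mxE -(enum_valK k).
  have [x <-] := p_surj (enum_val k).
  pose w y := u 0 (enum_rank (p y)).
  have := connect_invariant _ _ _ w (inv_ker u uM0) _ _ (connect_root e x).
  rewrite {1}/w => ->.
  have root_x : fingraph.root e x \in roots e by apply: roots_root.
  move/rowP/(_ (enum_rank_in root_x (fingraph.root e x))): uP0.
  by rewrite uP (enum_rankK_in _ root_x) -/(w _) => ->; rewrite mxE.
have <- : #|roots e| = n_comp e predT.
  by apply: eq_card => x; rewrite !inE andbT.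
rewrite -{1}(eqP free_MP) -mxrank_tr tr_row_mx -addsmxE.
apply: leq_trans (mxrank_adds_leqif _ _) _.
by rewrite !mxrank_tr leq_add2l rank_leq_col.
Qed.

Definition difference_mx (T E : finType) (p q : E -> T) :
    'M[rat]_(#|T|, #|E|) :=
  \matrix_(i, j) ((enum_val i == p (enum_val j))%:R
                  - (enum_val i == q (enum_val j))%:R).

Lemma mul_difference_mx (T E : finType) (p q : E -> T) (u : 'rV_#|T|) e :
  (u *m difference_mx _ _ p q) 0 (enum_rank e) =
  u 0 (enum_rank (p e)) - u 0 (enum_rank (q e)).
Proof.
have sum_at t : \sum_i u 0 i * (enum_val i == t)%:R = u 0 (enum_rank t).
  rewrite (bigD1 (enum_rank t)) //= enum_rankK eqxx mulr1 big1 ?addr0 // => i.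
  by rewrite -(inj_eq enum_val_inj) enum_rankK => /negPf->; rewrite mulr0.
rewrite mxE -!sum_at -sumrB; apply: eq_bigr => i _.
by rewrite mxE enum_rankK mulrBr.
Qed.

(** * Faces of a planar map and their Alexander numbering *)

Section Faces.
Variable D : diagram_map.
Implicit Types (x : edge_end D) (e : crossing D * bool).

Lemma other_endK : involutive (@other_end D).
Proof. by case=> e /=; rewrite ?permK ?permKV. Qed.

Lemma rotate_inj : injective (@rotate D).
Proof. by case=> [[c []]|[c []]] [[c' []]|[c' []]] //= [->]. Qed.

Lemma face_inj : injective (@face D).
Proof. exact: inj_comp rotate_inj (inv_inj other_endK). Qed.

Lemma adjacent_sym : connect_sym (@adjacent D).
Proof.
apply: sym_connect_sym => x y; rewrite /adjacent [y == _]eq_sym.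
by rewrite (inv_eq other_endK) [end_crossing y == _]eq_sym.
Qed.

Definition face_class := {x : edge_end D | froots (@face D) x}.

Definition face_of x : face_class :=
  Sub (froot (@face D) x) (roots_root (fconnect_sym face_inj) x).

Lemma face_of_val (f : face_class) : face_of (val f) = f.
Proof. by apply: val_inj; apply/eqP; case: f. Qed.

Lemma card_face_class : #|{: face_class}| = fcard (@face D) predT.
Proof. by rewrite card_sig; apply: eq_card => x; rewrite !inE andbT. Qed.

Lemma face_of_face x : face_of (face x) = face_of x.
Proof.
apply: val_inj; apply/eqP; rewrite /= (root_connect (fconnect_sym face_inj)).
by rewrite (fconnect_sym face_inj) fconnect1.
Qed.

Lemma face_of_rotate x : face_of (rotate x) = face_of (other_end x).
Proof. by rewrite -[RHS]face_of_face /face other_endK. Qed.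

(** [face] crosses to the far end and turns counterclockwise there, so the face of an end lies on
    the right when leaving its crossing. Leaving from the head of an edge runs backwards, which
    gives the left face. *)
Definition left_face e := face_of (inr (edge_map D e)).
Definition right_face e := face_of (inl e).

Lemma left_faceE e : left_face e = face_of (rotate (inl e)).
Proof. by rewrite face_of_rotate. Qed.

Lemma right_faceV e :
  right_face ((edge_map D)^-1%g e) = face_of (rotate (inr e)).
Proof. by rewrite face_of_rotate. Qed.

Lemma left_faceV e : left_face ((edge_map D)^-1%g e) = face_of (inr e).
Proof. by rewrite /left_face permKV. Qed.

(* Row space of [faces_mx]: coboundaries of functions on the faces.           *)
(* Kernel of [crossings_mx^T]: flows on the edges.                            *)
Definition faces_mx := difference_mx _ _ left_face right_face.
Definition crossings_mx :=
  difference_mx _ _ (fun e => e.1) (fun e => (edge_map D e).1).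

(** A function on faces with zero coboundary agrees across each edge, hence at the four corners of
    each crossing, hence along each component. *)
Lemma faces_mx_rank :
  (fcard (@face D) predT <= \rank faces_mx + n_comp (@adjacent D) predT)%N.
Proof.
rewrite -card_face_class.
apply: (invariant_kernel_rank _ face_of _ adjacent_sym).
  by move=> f; exists (val f); apply: face_of_val.
move=> u uM0; pose w x := u 0 (enum_rank (face_of x)).
have w_other x : w (other_end x) = w x.
  have edge e : w (inr (edge_map D e)) = w (inl e).
    apply/eqP; rewrite -subr_eq0 -(mul_difference_mx _ _ left_face right_face).
    by rewrite -/faces_mx uM0 mxE.
  by case: x => e /=; rewrite ?edge // -edge permKV.
have w_rotate x : w (rotate x) = w x.
  by rewrite /w face_of_rotate; apply: w_other.
have w_at c x : end_crossing x = c -> w x = w (inl (c, false)).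
  have wl := w_rotate (inl (c, false)); have wr := w_rotate (inl (c, true)).
  have wb := w_rotate (inr (c, true)).
  by case: x => [[_ []]|[_ []]] /= ->; rewrite ?wb ?wr ?wl // wb wr wl.
move=> x y /orP[/eqP->|/eqP eq_xy]; rewrite -!/(w _); first by rewrite w_other.
by rewrite (w_at _ _ eq_xy) (w_at _ y erefl).
Qed.

Lemma crossings_mx_rank :
  (#|crossing D| <= \rank crossings_mx + n_comp (@adjacent D) predT)%N.
Proof.
apply: (invariant_kernel_rank _ (@end_crossing D) _ adjacent_sym).
  by move=> c; exists (inl (c, true)).
move=> u uM0.
have edge e : u 0 (enum_rank (edge_map D e).1) = u 0 (enum_rank e.1).
  apply/eqP; rewrite eq_sym -subr_eq0.
  have := mul_difference_mx _ _ (fun e => e.1) (fun e => (edge_map D e).1) u e.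
  by rewrite /= => <-; rewrite -/crossings_mx uM0 mxE.
move=> x y /orP[/eqP->|/eqP-> //].
by case: x => e /=; rewrite ?edge // -[RHS]edge permKV.
Qed.

(** Net outflow of [G] at [c]. *)
Lemma sum_at_crossing (c : crossing D) (G : crossing D * bool -> rat) :
  \sum_e G e * ((c == e.1)%:R - (c == (edge_map D e).1)%:R) =
  \sum_s (G (c, s) - G ((edge_map D)^-1%g (c, s))).
Proof.
have sum_c (H : crossing D * bool -> rat) :
    \sum_e H e * (c == e.1)%:R = \sum_s H (c, s).
  transitivity (\sum_c' \sum_s H (c', s) * (c == c')%:R).
    by rewrite pair_bigA /=; apply: eq_bigr; case.
  rewrite (bigD1 c) //= [X in _ + X]big1 ?addr0.
    by apply: eq_bigr => s _; rewrite eqxx mulr1.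
  by move=> c' ne_c'; apply: big1 => s _; rewrite eq_sym (negPf ne_c') mulr0.
under eq_bigr => e _ do rewrite mulrBr.
rewrite !sumrB -(sum_c G) -(sum_c (fun e => G ((edge_map D)^-1%g e))).
congr (_ - _); rewrite (reindex_inj (@perm_inj _ (edge_map D)^-1%g)) /=.
by apply: eq_bigr => e _; rewrite permKV.
Qed.

Lemma faces_crossings_mx : faces_mx *m crossings_mx^T = 0.
Proof.
apply/matrixP => i j; rewrite !mxE.
pose G e : rat := (enum_val i == left_face e)%:R
                  - (enum_val i == right_face e)%:R.
transitivity (\sum_e G e * ((enum_val j == e.1)%:R
                            - (enum_val j == (edge_map D e).1)%:R)).
  rewrite [RHS](reindex _ (onW_bij _ (enum_val_bij _))) /=.
  by apply: eq_bigr => k _; rewrite !mxE.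
(* With corners W, N, E, S the outflow is (W - N) + (N - E) - (W - S) - (S - E) = 0. *)
rewrite sum_at_crossing big_bool /G !left_faceV !left_faceE !right_faceV /=.
by rewrite /right_face; ring.
Qed.

Lemma ones_crossings_mx : const_mx 1 *m crossings_mx^T = 0 :> 'rV_ _.
Proof.
apply/rowP => j; rewrite !mxE.
transitivity (\sum_e 1 * ((enum_val j == e.1)%:R
                          - (enum_val j == (edge_map D e).1)%:R : rat)).
  rewrite [RHS](reindex _ (onW_bij _ (enum_val_bij _))) /=.
  by apply: eq_bigr => k _; rewrite !mxE.
by rewrite (sum_at_crossing _ (fun=> 1)) big1 // => s _; rewrite subrr.
Qed.

Lemma planar_face_potential :
  planar D -> exists h : face_class -> rat,
    forall e, h (left_face e) = h (right_face e) + 1.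
Proof.
move=> planarD; have sub_ker : (faces_mx <= kermx crossings_mx^T)%MS.
  exact/sub_kermxP/faces_crossings_mx.
have : (kermx crossings_mx^T <= faces_mx)%MS.
  rewrite -(geq_leqif (mxrank_leqif_sup sub_ker)) mxrank_ker mxrank_tr.
  rewrite leq_subLR [leqLHS]card_prod card_bool.
  by move: crossings_mx_rank faces_mx_rank; rewrite planarD; lia.
move/(submx_trans (introT sub_kermxP ones_crossings_mx)) => /submxP[u Du].
exists (fun f => u 0 (enum_rank f)) => e; apply/eqP.
rewrite addrC -subr_eq -mul_difference_mx -/faces_mx -Du.
by rewrite mxE.
Qed.

(** The potential is rational, while exponents of [sigma] must be natural numbers. The shift by [B]
    makes it nonnegative, and truncation then commutes with adding 1. *)
Lemma planar_alexander_numbering :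
  planar D -> exists A : face_class -> nat,
    forall e, A (left_face e) = (A (right_face e)).+1.
Proof.
move=> /planar_face_potential[h hE]; pose B := \sum_f `|h f|.
have hB f : 0 <= h f + B.
  rewrite /B (bigD1 f) //= addrA addr_ge0 ?sumr_ge0 //.
  by rewrite -lerBlDl sub0r -normrN ler_norm.
exists (fun f => Num.truncn (h f + B)) => e; apply: truncn_def.
rewrite hE addrAC -natr1 -[X in _ < X]natr1 lerD2r ltrD2r.
exact: truncn_itv.
Qed.

End Faces.

(** * Transport of colors along a knot *)

Section Knot.
Variables (D : diagram) (n : nat) (sigma : 'S_n).

Lemma follow_inj : injective (@follow D).
Proof.
move=> e e' [eq1 /negb_inj eq2]; apply: (@perm_inj _ (edge_map D)).
by rewrite [LHS]surjective_pairing [RHS]surjective_pairing eq1 eq2.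
Qed.

Lemma knot_fconnect : knot D -> forall e e', fconnect (@follow D) e e'.
Proof.
rewrite /knot /components => knotD e e'.
have sym := fconnect_sym follow_inj.
rewrite -(root_connect sym); apply/eqP.
(* The number of orbits is 0 when the knot is a circle without crossings. *)
have /card_le1_eqP : (fcard (@follow D) predT <= 1)%N.
  by rewrite -knotD leq_addr.
by apply; rewrite !inE andbT; apply: roots_root.
Qed.

(** Changing the sign exchanges over and under and also inverts the permutations, so the strand
    going from right to left gets [sigma] at either sign. *)
Lemma coloring_classicalE
    (d : {ffun (crossing D * bool) + 'I_(circles D) -> 'I_n}) :
  classical D -> d \in colorings D sigma -> forall c,
    color_out d (c, true) = sigma (color_in d (c, false)) /\
    color_in d (c, true) = sigma (color_out d (c, false)).
Proof.
move=> classicalD; rewrite inE => /forallP col_d c; move: (col_d c).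
case kc: (kind c) => [[]|]; last by case: (classicalD c).
  by move=> /andP[/eqP-> /eqP->]; rewrite /= permKV.
by move=> /andP[/eqP-> /eqP->]; rewrite /= permKV.
Qed.

Lemma coloring_monochromatic
    (d : {ffun (crossing D * bool) + 'I_(circles D) -> 'I_n}) :
    knot D -> classical D -> d \in colorings D sigma ->
  forall c, monochromatic d c.
Proof.
move=> knotD classicalD col_d.
have colE := coloring_classicalE _ classicalD col_d.
have [A AE] : exists A : face_class D -> nat,
    forall e, A (left_face _ e) = (A (right_face _ e)).+1.
  by apply: planar_alexander_numbering; case: D.
pose g e := (sigma ^- A (left_face _ e))%g (color_out d e).
have stepK k x : (sigma ^- k.+1)%g (sigma x) = (sigma ^- k)%g x.
  by rewrite expgSr invMg permM permK.
have g_follow e : g (follow e) = g e.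
  rewrite -{2}[e](permK (edge_map D)) /follow; case: (edge_map D e) => c s /=.
  have := AE (c, true); have := AE (c, false).
  have := AE ((edge_map D)^-1%g (c, true)).
  have := AE ((edge_map D)^-1%g (c, false)).
  (* [WS] and [WN] compare the corner left of the crossing with those below and above it. *)
  rewrite /g !left_faceV !left_faceE !right_faceV /right_face /= => _ WS _ WN.
  have [colT colF] := colE c.
  case: s => /=; rewrite -[X in _ = _ X]/(color_in d (c, _)).
    by rewrite WN colF stepK.
  by rewrite WS colT stepK.
have gE e e' : g e = g e'.
  apply: (fconnect_invariant _ (knot_fconnect knotD e e')) => x.
  by rewrite /= g_follow eqxx.
move=> c; rewrite /monochromatic; case: (kind c) (classicalD c) => // _ _.
have := gE (c, true) ((edge_map D)^-1%g (c, true)).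
rewrite /g left_faceV left_faceE /= -/(color_in d _) => /perm_inj->.
exact: eqxx.
Qed.

End Knot.

Theorem corollary5 (n : nat) (sigma : 'S_n) (D : diagram) :
  knot D -> classical D ->
  jones D sigma = #|colorings D sigma|%:R * jones D (1%g : 'S_1).
Proof.
move=> knotD classicalD.
(* The common contribution of each coloring: every crossing is smoothed. *)
pose J := (- (var_a ^+ 2 * var_b^-1)) ^ (- writhe D) *
  \sum_(s : {ffun crossing D -> smoothing} | [forall c, s c != Crossed])
    (\prod_(c : crossing D) factor s c) *
    (- (var_a * var_b^-1) - var_b * var_a^-1) ^+ curves s.
have jonesE m (tau : 'S_m) : jones D tau = #|colorings D tau|%:R * J.
  rewrite mulr_natl -sumr_const; apply: eq_bigr => d col_d; congr (_ * _).
  apply: eq_bigl => s; rewrite inE; apply: eq_forallb => c.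
  by rewrite (coloring_monochromatic _ _ _ _ knotD classicalD col_d) eqb_id.
rewrite !jonesE; congr (_ * _).
suff -> : #|colorings D (1%g : 'S_1)| = 1%N by rewrite mul1r.
have -> : colorings D (1%g : 'S_1) = setT.
  apply/setP => d; rewrite !inE; apply/forallP => c.
  by case: (kind c) => [p|]; apply/andP; split; apply/eqP;
     rewrite [LHS]ord1 [RHS]ord1.
by rewrite cardsT card_ffun card_ord exp1n.
Qed.
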